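(* Let $X$ be a real Banach space. Let $F:[0,1]\to\mathrm{b}(X)$ be a multifunction with precompact values (i.e. $F(t)$ is precompact for every $t\in[0,1]$) such that its convex hull $\operatorname{conv}F$ is Riemann integrable. Then the multifunction $F$ is also Riemann integrable.
   Context: Let $\mathrm{b}(X)$ be the collection of all non-empty bounded subsets of $X$ and $\mathrm{clb}(X)$ the subcollection of closed ones. A multifunction $F:[0,1]\to\mathrm{b}(X)$ is a map assigning to each $t\in[0,1]$ a non-empty bounded set $F(t)\subset X$. $\operatorname{conv}F$ is the multifunction $t\mapsto\operatorname{conv}(F(t))$ (ordinary convex hull, no closure taken). A subset of $X$ is precompact if it is totally bounded (equivalently, its closure in $X$ is compact). For $A,B\subset X$ and a scalar $\lambda$: $A+B=\{a+b: a\in A, b\in B\}$ (Minkowski sum), $\lambda A=\{\lambda a: a\in A\}$. The Hausdorff distance (a pseudometric on $\mathrm{b}(X)$) is $\rho_H(A,B)=\max\{\sup_{b\in B}\rho(b,A),\ \sup_{a\in A}\rho(a,B)\}$, where $\rho(x,A)=\inf_{a\in A}\|x-a\|$. A tagged partition $T=\{\Delta_i,t_i\}_{i=1}^n$ of $[0,1]$ consists of a partition of $[0,1]$ into consecutive intervals $\Delta_i=[x_{i-1},x_i]$, $0=x_0<\dots<x_n=1$, and points $t_i\in\Delta_i$; $d(T)=\max_i|\Delta_i|$, where $|\Delta_i|$ is the length. The Riemann sum is $S(F,T)=\sum_{i=1}^n|\Delta_i|F(t_i)$. $F$ is Riemann integrable if there is a set $A\in\mathrm{clb}(X)$ (then unique,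 called the Riemann integral $\int_0^1F(t)\,dt$) such that for every $\varepsilon>0$ there is $\delta>0$ with $\rho_H(S(F,T),A)<\varepsilon$ for every tagged partition $T$ with $d(T)<\delta$. *)

(* Defs.v *)
From HB Require Import structures.
From mathcomp Require Import all_boot all_order all_algebra finmap.
From mathcomp Require Import all_classical all_reals all_analysis.

Set Implicit Arguments.
Unset Strict Implicit.
Unset Printing Implicit Defensive.

Import Order.TTheory GRing.Theory Num.Theory.
Import numFieldNormedType.Exports.

Local Open Scope classical_set_scope.
Local Open Scope ring_scope.

Section bounded_subsets.
Context {R : realType} {X : normedModType R}.
Implicit Types A B : set X.

Definition bX A := A !=set0 /\ bounded_set A.

Definition clbX A := bX A /\ closed A.

Definition conv_hull A : set X := smallest (@convex_set R X) A.

Definition minkowski_sum A B : set X := [set a + b | a in A & b in B].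

Definition set_scale (l : R) A : set X := [set l *: a | a in A].

(* Extended-real valued, so that no value is junk: on non-empty bounded sets
   both quantities below are finite. *)
Definition dist_to_set (x : X) A : \bar R :=
  ereal_inf [set (`|x - a|)%:E | a in A].

Definition hausdorff_dist A B : \bar R :=
  Order.max (ereal_sup [set dist_to_set b A | b in B])
            (ereal_sup [set dist_to_set a B | a in A]).

Definition totally_bounded A :=
  forall e : R, 0 < e ->
    exists2 D : set X, finite_set D & A `<=` \bigcup_(x in D) ball x e.

End bounded_subsets.

(* [precompact] asks for the closure to be compact; in a Banach space this is
   total boundedness. *)
Lemma precompact_totally_bounded {R : realType} {X : completeNormedModType R}
  (A : set X) : precompact A <-> totally_bounded A.
Proof.
rewrite precompactE; split => [cA e e0|tA].
  have /= := cA; rewrite compact_cover => /(_ X setT (fun x => ball x e)).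
  case=> [x _|x _|D _ AD].
  - exact: ball_open.
  - by exists x => //; exact: ballxx.
  by exists [set` D] => //; exact: subset_trans (@subset_closure _ A) AD.
rewrite compact_ultra => F FU FA.
have Fcauchy : cauchy F.
  apply: cauchy_exP => e e0.
  have [D /finite_fsetP[D' DD'] AD] := tA _ (divr_gt0 e0 (ltr0n _ 2)).
  apply: contrapT => /forallNP Fe.
  have F0 : F (\bigcap_(x in [set` D']) ~` ball x e).
    by apply: filter_bigI => x _; case: (in_ultra_setVsetC (ball x e) FU) => // /Fe.
  have [x [Ax Dx]] := filter_ex (filterI FA F0).
  have [y [Ay xy]] := Ax _ (nbhsx_ballx x _ (divr_gt0 e0 (ltr0n _ 2))).
  have [z Dz zy] := AD _ Ay.
  apply: (Dx z); first by rewrite -DD'.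
  by rewrite [e]splitr; apply: ball_triangle zy _; exact: ball_sym.
have Fcvg : cvg F by exact: (cauchy_cvg F).
exists (lim F); split; last exact: Fcvg.
exact: (@closed_cvg _ _ F _ id _ (@closed_closure _ A) FA _ Fcvg).
Qed.

(* The partition [0 = x_0 < x_1 < ... < x_n = 1] is given by the sequence
   [s = x_1, ..., x_n]; the interval of index [i < n] (counted from 0) is
   [[x_i, x_(i+1)]] and its tag is the [i]-th element of [t]. *)
Section tagged_partitions.
Context {R : realType}.
Implicit Types s t : seq R.

Definition subitv_left s (i : nat) : R := nth 1 (0 :: s) i.

Definition subitv_right s (i : nat) : R := nth 1 s i.

Definition subitv_length s (i : nat) : R := subitv_right s i - subitv_left s i.

Definition tagged_partition s t :=
  [/\ itv_partition 0 1 s,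
      size t = size s &
      forall i, (i < size s)%N -> subitv_left s i <= t`_i <= subitv_right s i].

Definition mesh s : R := \big[Num.max/0]_(i < size s) subitv_length s i.

End tagged_partitions.

(* Multifunctions on [0, 1] are functions on [R] of which only the values on
   [0, 1] matter: all the tags lie in [0, 1]. *)
Section riemann_integral.
Context {R : realType} {X : normedModType R}.
Implicit Types F : R -> set X.

Definition riemann_sum F (s t : seq R) : set X :=
  \big[minkowski_sum/[set 0]]_(i < size s) set_scale (subitv_length s i) (F t`_i).

Definition is_riemann_integral F (A : set X) :=
  clbX A /\
  forall e : R, 0 < e -> exists2 d : R, 0 < d &
    forall s t : seq R, tagged_partition s t -> mesh s < d ->
      (hausdorff_dist (riemann_sum F s t) A < e%:E)%E.

Definition riemann_integrable F := exists A : set X, is_riemann_integral F A.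

End riemann_integral.

(* Main.v *)
From HB Require Import structures.
Require Import Defs.
From mathcomp Require Import all_boot all_order all_algebra.
From mathcomp Require Import all_classical all_reals all_analysis.
From mathcomp Require Import ring lra.
Import Order.TTheory GRing.Theory Num.Theory.
Import numFieldNormedType.Exports.
Local Open Scope classical_set_scope.
Local Open Scope ring_scope.

(** Let [A] be the Riemann integral of [conv F].  It is also the integral of [F],
    and since Riemann sums of [F] lie inside those of [conv F], the only point
    is that every [y = sum_i l_i y_i] with [y_i] in [conv (F t_i)] can be
    approximated by some [x = sum_i l_i a_i] with [a_i] in [F t_i], uniformly
    over all fine partitions ([riemann_sum_conv_hull_approx]).

    In a Hilbert space the [a_i] could be chosen greedily: given the error
    [w = sum_(k < i) l_k (a_k - y_k)] made so far, a point of [conv (F t_i)]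
    never lies strictly on one side of all of [F t_i], so some [a_i] satisfies
    [<w, a_i - y_i> <= 0].  The squared error then grows by at most
    [l_i ^ 2 C ^ 2] at each step, hence stays below
    [C ^ 2 * sum_i l_i ^ 2 <= C ^ 2 * mesh].  In a general Banach space the same
    selection controls the quadratic form [sum_j (f_j w) ^ 2] of finitely many
    functionals [f_j] of norm at most 1 ([sum_squares_selection]).

    It remains to find finitely many functionals, the same for all fine
    partitions, that almost compute the norm of the error [x - y].  Here
    precompactness comes in.  Convex hulls and Minkowski sums of totally bounded
    sets are totally bounded, so the Riemann sums of [conv F] are, and so is
    their limit [A].  As soon as the partition is fine, [x] and [y] are close to
    [A], and [x - y] is close to a finite net of [A - A]; functionals norming the
    points of this net, given by the Hahn-Banach theorem, do the job
    ([norm_lt_near_normed]).  The constant [C] exists because an integrable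
    multifunction is bounded ([riemann_integrable_bounded]). *)

(** * Linear functionals below a sublinear one *)

(** Homogeneity is only asked as an inequality: applying it to a scalar and to
    its inverse gives the equality ([sublinearZ]). *)
Definition sublinear {R : realType} {X : lmodType R} (p : X -> R) :=
  (forall x y, p (x + y) <= p x + p y) /\
  (forall c x, 0 <= c -> p (c *: x) <= c * p x).

Lemma sublinear0 {R : realType} {X : lmodType R} (p : X -> R) :
  sublinear p -> p 0 = 0.
Proof.
move=> [pD pZ]; apply/eqP; rewrite eq_le.
have := pZ 0 0 (lexx _); rewrite scaler0 mul0r => -> /=.
by have := pD 0 0; rewrite addr0 -subr_ge0 addrK.
Qed.

Lemma sublinearZ {R : realType} {X : lmodType R} (p : X -> R) c x :
  sublinear p -> 0 <= c -> p (c *: x) = c * p x.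
Proof.
move=> sp; rewrite le_eqVlt => /predU1P[<-|c0].
  by rewrite scale0r mul0r sublinear0.
have [_ pZ] := sp; apply/eqP; rewrite eq_le pZ ?(ltW c0)//=.
have := pZ c^-1 (c *: x); rewrite invr_ge0 (ltW c0) => /(_ isT).
by rewrite scalerA mulVf ?gt_eqF// scale1r ler_pdivlMl.
Qed.

Lemma sublinear_ge {R : realType} {X : lmodType R} (p : X -> R) x :
  sublinear p -> - p (- x) <= p x.
Proof.
move=> sp; have := sp.1 x (- x); rewrite subrr sublinear0//; lra.
Qed.

(** The largest sublinear function below [p] that is at most [- p y] at [- y].
    It serves twice: to show that a minimal sublinear function is additive, and
    to force a functional below [p] to agree with [p] at [y]. *)
Definition shift {R : realType} {X : lmodType R} (p : X -> R) (y x : X) : R :=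
  inf [set p (x + t *: y) - t * p y | t in [set t | 0 <= t]].

(** A lower bound independent of [t], by subadditivity applied to
    [t *: y = (x + t *: y) - x]; without it the infimum would be meaningless. *)
Lemma shift_has_lbound {R : realType} {X : lmodType R} (p : X -> R) y x :
  sublinear p ->
  lbound [set p (x + t *: y) - t * p y | t in [set t | 0 <= t]] (- p (- x)).
Proof.
move=> sp _ [t /= t0 <-]; have := sp.1 (x + t *: y) (- x).
by rewrite addrAC subrr add0r sublinearZ//; lra.
Qed.

Lemma shift_le {R : realType} {X : lmodType R} (p : X -> R) y x t :
  sublinear p -> 0 <= t -> shift p y x <= p (x + t *: y) - t * p y.
Proof.
move=> sp t0; apply: ge_inf; first by exists (- p (- x)); exact: shift_has_lbound.
by exists t.
Qed.

Lemma le_shift {R : realType} {X : lmodType R} (p : X -> R) y x b :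
  (forall t, 0 <= t -> b <= p (x + t *: y) - t * p y) -> b <= shift p y x.
Proof.
move=> h; apply: lb_le_inf; first by exists (p (x + 0 *: y) - 0 * p y); exists 0 => /=.
by move=> _ [t /= t0 <-]; exact: h.
Qed.

Lemma shift_sublinear {R : realType} {X : lmodType R} (p : X -> R) y :
  sublinear p -> sublinear (shift p y).
Proof.
move=> sp; split=> [x x'|c x].
  rewrite -lerBlDl; apply: le_shift => t t0.
  rewrite lerBlDl -lerBlDr; apply: le_shift => s s0.
  rewrite lerBlDr; apply: (le_trans (shift_le p y _ (s + t) sp (addr_ge0 s0 t0))).
  have := sp.1 (x + s *: y) (x' + t *: y).
  by rewrite addrACA -scalerDl; lra.
rewrite le_eqVlt => /predU1P[<-|c0].
  rewrite mul0r scale0r; apply: (le_trans (shift_le p y _ 0 sp (lexx _))).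
  by rewrite scale0r addr0 sublinear0// mul0r subr0.
rewrite -ler_pdivrMl//; apply: le_shift => t t0; rewrite ler_pdivrMl//.
apply: (le_trans (shift_le p y _ (c * t) sp (mulr_ge0 (ltW c0) t0))).
by rewrite -scalerA -scalerDr sublinearZ ?(ltW c0)// mulrBr mulrA.
Qed.

(** By minimality [p <= shift p y], and the term [t = 1] of the infimum defining
    [shift p y x] reads [p (x + y) - p y]. *)
Lemma minimal_sublinear_additive {R : realType} {X : lmodType R} (p : X -> R) :
  sublinear p ->
  (forall q, sublinear q -> (forall x, q x <= p x) -> forall x, p x <= q x) ->
  {morph p : x y / x + y}.
Proof.
move=> sp pmin x y; apply/eqP; rewrite eq_le sp.1/=.
have := pmin _ (shift_sublinear p y sp) _ x.
have le_p z : shift p y z <= p z.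
  apply: (le_trans (shift_le p y z 0 sp (lexx _))).
  by rewrite scale0r addr0 mul0r subr0.
move=> /(_ le_p) px; have := shift_le p y x 1 sp ler01.
by rewrite scale1r mul1r; lra.
Qed.

(** Zorn's lemma: the pointwise infimum of a chain of sublinear functions is
    sublinear, because of any two members of a chain the smaller one bounds both
    infima at once. *)
Lemma minimal_sublinear_exists {R : realType} {X : lmodType R} (p0 : X -> R) :
  sublinear p0 -> exists p, [/\ sublinear p, forall x, p x <= p0 x &
  forall q, sublinear q -> (forall x, q x <= p x) -> forall x, p x <= q x].
Proof.
move=> sp0; pose T := {p : X -> R | sublinear p /\ forall x, p x <= p0 x}.
pose t0 : T := exist _ p0 (conj sp0 (fun=> lexx _)).
pose ord (p q : T) := `[< forall x, sval q x <= sval p x >].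
have [||C Ctot|[p [sp pp0]] pmin] := @ZL_preorder T t0 ord.
- by move=> p; apply/asboolP.
- move=> q p r /asboolP h1 /asboolP h2; apply/asboolP => x.
  exact: le_trans (h2 x) (h1 x).
- have [->|/set0P[c0 Cc0]] := eqVneq C set0; first by exists t0.
  pose I x := [set sval c x | c in C].
  have I_lb x : lbound (I x) (- p0 (- x)).
    move=> _ [c Cc <-]; have [sc cp] := svalP c.
    by apply: le_trans (sublinear_ge _ x sc); rewrite lerN2.
  have Ile c x : C c -> inf (I x) <= sval c x.
    by move=> Cc; apply: ge_inf; [exists (- p0 (- x))|exists c].
  have inf_ge x b : (forall c, C c -> b <= sval c x) -> b <= inf (I x).
    move=> h; apply: lb_le_inf; first by exists (sval c0 x); exists c0.
    by move=> _ [c Cc <-]; exact: h.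
  have sI : sublinear (fun x => inf (I x)) /\ forall x, inf (I x) <= p0 x.
    split; last by move=> x; apply: (le_trans (Ile c0 x Cc0)); exact: (svalP c0).2.
    split=> [x y|k x].
      rewrite -lerBlDl; apply: (inf_ge) => c Cc.
      rewrite lerBlDl -lerBlDr; apply: (inf_ge) => d Cd; rewrite lerBlDr.
      have [/asboolP dc|/asboolP cd] := Ctot _ _ Cc Cd.
        apply: (le_trans (Ile d _ Cd)); apply: (le_trans ((svalP d).1.1 x y)).
        by rewrite lerD2l.
      apply: (le_trans (Ile c _ Cc)); apply: (le_trans ((svalP c).1.1 x y)).
      by rewrite lerD2r.
    rewrite le_eqVlt => /predU1P[<-|k0].
      rewrite mul0r scale0r; apply: (le_trans (Ile c0 _ Cc0)).
      by rewrite (sublinear0 _ (svalP c0).1).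
    rewrite -ler_pdivrMl//; apply: (inf_ge) => c Cc; rewrite ler_pdivrMl//.
    by apply: (le_trans (Ile c _ Cc)); apply: (svalP c).1.2; exact: ltW.
  by exists (exist _ (fun x => inf (I x)) sI : T) => c Cc; apply/asboolP => x /=; exact: Ile.
- exists p; split => // q sq qp.
  have qp0 : sublinear q /\ forall x, q x <= p0 x.
    by split => // x; exact: le_trans (qp x) (pp0 x).
  by have /pmin/asboolP : ord (exist _ p (conj sp pp0)) (exist _ q qp0)
    by apply/asboolP.
Qed.

(** A minimal sublinear function below [shift p z] is linear, and at [- z] it is
    at most [- p z]. *)
Lemma hahn_banach {R : realType} {X : lmodType R} (p : X -> R) (z : X) :
  sublinear p ->
  exists2 f : {scalar X}, (forall x, f x <= p x) & f z = p z.
Proof.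
move=> sp.
have [f [sf fp /(minimal_sublinear_additive f sf) fD]] :=
  minimal_sublinear_exists _ (shift_sublinear p z sp).
have fN x : f (- x) = - f x.
  by apply/eqP; rewrite -addr_eq0 -fD addrC subrr sublinear0.
have fZ (c : R) x : f (c *: x) = c * f x.
  have [c0|c0] := leP 0 c; first exact: sublinearZ.
  rewrite -[c *: x]opprK -scaleNr fN sublinearZ ?oppr_ge0 ?(ltW c0)//.
  by rewrite mulNr opprK.
have lf : linear_for *%R f by move=> c x y; rewrite fD fZ.
pose fL : {scalar X} := HB.pack f (GRing.isLinear.Build R X R *%R f lf).
have fLp x : fL x <= p x.
  apply: (le_trans (fp x)); apply: (le_trans (shift_le p z x 0 sp (lexx _))).
  by rewrite scale0r addr0 mul0r subr0.
exists fL => //; apply/eqP; rewrite eq_le fLp/= -lerN2 -fN.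
apply: (le_trans (fp _)); apply: (le_trans (shift_le p z _ 1 sp ler01)).
by rewrite scale1r addNr sublinear0// mul1r sub0r.
Qed.

(** * Convex hulls and total boundedness *)

Lemma convex_setP {R : realType} {X : lmodType R} (A : set X) :
  (forall x y (k : R), 0 <= k <= 1 -> A x -> A y ->
    A (k *: x + (1 - k) *: y)) ->
  @convex_set R X A.
Proof.
move=> h x y k /set_mem Ax /set_mem Ay; apply/mem_set; apply: h => //.
by rewrite ge0 le1.
Qed.

Lemma convexZD {R : realType} {X : lmodType R} (A : set X) x y (k : R) :
  @convex_set R X A -> 0 <= k <= 1 -> A x -> A y -> A (k *: x + (1 - k) *: y).
Proof.
move=> cA /andP[k0 k1] Ax Ay.
exact/set_mem/(cA x y (Itv01 k0 k1) (mem_set Ax) (mem_set Ay)).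
Qed.

Lemma convex_minkowski_sum {R : realType} {X : normedModType R} (A B : set X) :
  @convex_set R X A -> @convex_set R X B -> @convex_set R X (minkowski_sum A B).
Proof.
move=> cA cB; apply: convex_setP => _ _ k k01 [a Aa [b Bb <-]] [c Ac [d Bd <-]].
exists (k *: a + (1 - k) *: c); first exact: convexZD.
exists (k *: b + (1 - k) *: d); first exact: convexZD.
by rewrite addrACA -!scalerDr.
Qed.

Lemma convex_ball0 {R : realType} {X : normedModType R} (e : R) :
  @convex_set R X (ball (0 : X) e).
Proof.
apply: convex_setP => x y k /andP[k0 k1]; rewrite -ball_normE/= !sub0r !normrN.
move=> xe ye; apply: (le_lt_trans (ler_normD _ _)); rewrite !normrZ.
rewrite (ger0_norm k0) (@ger0_norm _ (1 - k)) ?subr_ge0//.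
move: k0; rewrite le_eqVlt => /predU1P[<-|k0]; first by rewrite mul0r; lra.
have : k * `|x| < k * e by rewrite ltr_pM2l.
have : (1 - k) * `|y| <= (1 - k) * e by rewrite ler_wpM2l ?subr_ge0// ltW.
lra.
Qed.

Lemma totally_bounded_approx {R : realType} {X : normedModType R} (A : set X) :
  (forall e : R, 0 < e -> exists2 B, totally_bounded B &
    forall a, A a -> exists2 b, B b & `|a - b| < e) ->
  totally_bounded A.
Proof.
move=> h e e0; have e20 : 0 < e / 2 by rewrite divr_gt0.
have [B tB AB] := h _ e20; have [D fD BD] := tB _ e20.
exists D => // a /AB[b /BD[x Dx]]; rewrite -?ball_normE/= => xb ab.
exists x => //; rewrite -?ball_normE/=; have := ler_distD b x a.
by rewrite (distrC b a); lra.
Qed.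

Lemma totally_bounded_set1 {R : realType} {X : normedModType R} (x : X) :
  totally_bounded [set x].
Proof.
by move=> e e0; exists [set x] => // _ ->; exists x => //; exact: ballxx.
Qed.

Lemma totally_bounded_minkowski_sum {R : realType} {X : normedModType R}
    (A B : set X) :
  totally_bounded A -> totally_bounded B -> totally_bounded (minkowski_sum A B).
Proof.
move=> tA tB e e0; have e20 : 0 < e / 2 by rewrite divr_gt0.
have [D fD AD] := tA _ e20; have [E fE BE] := tB _ e20.
exists (minkowski_sum D E); first exact: finite_image2.
move=> _ [a /AD[x Dx xa] [b /BE[y Ey yb] <-]].
exists (x + y); first by exists x => //; exists y.
move: xa yb; rewrite -!ball_normE/= => xa yb.
have := ler_normD (x - a) (y - b); rewrite opprD addrACA; lra.
Qed.

Lemma totally_bounded_scale {R : realType} {X : normedModType R} (l : R)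
    (A : set X) :
  totally_bounded A -> totally_bounded (set_scale l A).
Proof.
move=> tA e e0; have l0 : 0 < `|l| + 1 by rewrite ltr_wpDl.
have [D fD AD] := tA _ (divr_gt0 e0 l0).
exists (set_scale l D); first exact: finite_image.
move=> _ [a /AD[x Dx]] + <-; rewrite -ball_normE/= ltr_pdivlMr// => xa.
exists (l *: x); first by exists x.
rewrite -?ball_normE/= -scalerBr normrZ.
by have := normr_ge0 (x - a); nra.
Qed.

Lemma totally_bounded_segment {R : realType} {X : completeNormedModType R}
    (x : X) :
  totally_bounded [set t *: x | t in `[(0 : R), 1]].
Proof.
apply/precompact_totally_bounded; rewrite precompactE.
have cS : compact [set t *: x | t in `[(0 : R), 1]].
  apply: continuous_compact; last exact: segment_compact.
  by apply: continuous_subspaceT => t; exact: scalel_continuous.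
by rewrite -(closure_id _).1//; apply: compact_closed => //; exact: norm_hausdorff.
Qed.

(** The sum of the segments [[0, 1] x] over the points [x] of [s].  It is larger
    than the convex hull of [s], but its convexity and total boundedness are
    inherited from those of a segment.  Having [0] in it makes each point of [s]
    a sum whose other terms vanish. *)
Lemma finite_sub_convex_totally_bounded {R : realType}
    {X : completeNormedModType R} (s : seq X) :
  exists K : set X, [/\ @convex_set R X K, totally_bounded K, K 0 &
    forall x, x \in s -> K x].
Proof.
elim: s => [|x s [K [cK tK K0 sK]]].
  exists [set 0]; split=> //; last exact: totally_bounded_set1.
  by apply: convex_setP => _ _ k _ -> ->; rewrite !scaler0 addr0.
exists (minkowski_sum [set t *: x | t in `[(0 : R), 1]] K); split.
- apply: convex_minkowski_sum => //.
  apply: convex_setP => _ _ k /andP[k0 k1] [t + <-] [u + <-].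
  rewrite /= !in_itv/= => /andP[t0 t1] /andP[u0 u1].
  exists (k * t + (1 - k) * u); last by rewrite !scalerA -scalerDl.
  by rewrite /= in_itv/=; apply/andP; split; nra.
- by apply: totally_bounded_minkowski_sum => //; exact: totally_bounded_segment.
- exists 0; last by exists 0 => //; rewrite addr0.
  by exists 0; rewrite ?scale0r//= in_itv/= lexx ler01.
- move=> y; rewrite inE => /predU1P[->|/sK Ky].
    exists x; last by exists 0 => //; rewrite addr0.
    by exists 1; rewrite ?scale1r//= in_itv/= lexx ler01.
  exists 0; last by exists y => //; rewrite add0r.
  by exists 0; rewrite ?scale0r//= in_itv/= lexx ler01.
Qed.

Lemma sub_conv_hull {R : realType} {X : normedModType R} (A : set X) :
  A `<=` conv_hull A.
Proof. exact: sub_gen_smallest. Qed.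

(** If [A] is within [e] of a finite set, it lies in the [e]-neighbourhood of a
    totally bounded convex set [K]; this neighbourhood is convex, so it also
    contains the convex hull of [A]. *)
Lemma totally_bounded_conv_hull {R : realType} {X : completeNormedModType R}
    (A : set X) :
  totally_bounded A -> totally_bounded (conv_hull A).
Proof.
move=> tA; apply: totally_bounded_approx => e e0.
have [D /finite_seqP[s ->] AD] := tA _ e0.
have [K [cK tK _ sK]] := finite_sub_convex_totally_bounded s.
exists K => // a.
suff /[apply] : conv_hull A `<=` minkowski_sum K (ball 0 e).
  move=> [b Kb [c + <-]]; rewrite -ball_normE/= sub0r normrN => ce.
  by exists b => //; rewrite addrAC subrr add0r.
apply: smallest_sub.
  by apply: convex_minkowski_sum => //; exact: convex_ball0.
move=> b /AD[x /sK Kx]; rewrite -ball_normE/= => xb.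
exists x => //; exists (b - x); last by rewrite addrCA subrr addr0.
by rewrite -?ball_normE/= sub0r normrN distrC.
Qed.

(** * Norming functionals *)

Lemma norming_functionals {R : realType} (X : normedModType R) :
  exists f : X -> {scalar X},
    forall x, f x x = `|x| /\ forall z, `|f x z| <= `|z|.
Proof.
suff /choice[f fP] : forall x : X, exists g : {scalar X},
    g x = `|x| /\ forall z, `|g z| <= `|z| by exists f.
move=> x; have [|g gle gx] := @hahn_banach R X (fun y => `|y|) x.
  by split=> [y z|c y c0]; [exact: ler_normD|rewrite normrZ ger0_norm].
exists g; split=> // z; rewrite ler_norml gle andbT lerNl -(linearN g).
by rewrite -(normrN z).
Qed.

(** A functional norming [x] almost norms every point close to [x]. *)
Lemma norm_lt_near_normed {R : realType} {X : normedModType R} (f : {scalar X})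
    (x z : X) (c d : R) :
  f x = `|x| -> (forall y, `|f y| <= `|y|) -> `|x - z| < d -> f z <= c ->
  `|z| < c + 2 * d.
Proof.
move=> fx fle xz fz.
have : `|x| - f z <= `|x - z|.
  by rewrite -fx -linearB; exact: le_trans (ler_norm _) (fle _).
have := ler_normB x (x - z); rewrite opprB addrC subrK; lra.
Qed.

(** * Greedy selection from the sets of a convex combination *)

(** Otherwise [A], hence its convex hull, would lie in the half-space
    [g > g y]. *)
Lemma conv_hull_exists_le {R : realType} {X : normedModType R} (A : set X)
    (y : X) (g : X -> R) :
  linear_for *%R g -> conv_hull A y -> exists2 a, A a & g a <= g y.
Proof.
move=> lg Ay; apply: contrapT => /forall2NP nle.
suff : conv_hull A `<=` [set x | g y < g x] by move=> /(_ _ Ay) /=; rewrite ltxx.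
apply: smallest_sub => [|a Aa /=]; last first.
  by have [//|/negP] := nle a; rewrite -ltNge.
have gZ c x : g (c *: x) = c * g x.
  have := lg c x 0; have := lg 1 0 0.
  by rewrite scale1r mul1r !addr0 => g0 ->; lra.
apply: convex_setP => u v k /andP[k0 k1] /= yu yv; rewrite lg gZ.
move: k0; rewrite le_eqVlt => /predU1P[<-|k0]; first by rewrite mul0r; lra.
have : k * g y < k * g u by rewrite ltr_pM2l.
have : (1 - k) * g y <= (1 - k) * g v by rewrite ler_wpM2l ?subr_ge0// ltW.
lra.
Qed.

(** With [w] the error of the first [n] terms, the functional
    [sum_j f_j w * f_j] is half the derivative at [w] of the sum of the squares.
    Choosing the next point where it is not larger than at [y n] makes the cross
    term nonpositive, so that only the quadratic term of the new error adds
    up. *)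
Lemma sum_squares_selection {R : realType} {X : normedModType R} {I : Type}
    (f : I -> {scalar X}) (r : seq I) (n : nat) (l : nat -> R)
    (A : nat -> set X) (y : nat -> X) (C : R) :
  (forall j z, `|f j z| <= `|z|) ->
  (forall i, (i < n)%N -> 0 <= l i) ->
  (forall i, (i < n)%N -> conv_hull (A i) (y i)) ->
  (forall i a, (i < n)%N -> A i a -> `|a - y i| <= C) ->
  exists2 a : nat -> X, forall i, (i < n)%N -> A i (a i) &
    \sum_(j <- r) f j (\sum_(i < n) l i *: (a i - y i)) ^+ 2 <=
    (size r)%:R * C ^+ 2 * \sum_(i < n) l i ^+ 2.
Proof.
move=> fle; elim: n => [_ _ _|n IH l0 Ay AC].
  exists y => //; rewrite !big_ord0 mulr0 big1// => j _.
  by rewrite linear0 expr0n.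
have [a Aa aS] := IH (fun i iln => l0 _ (leqW iln)) (fun i iln => Ay _ (leqW iln))
  (fun i b iln => AC _ b (leqW iln)).
set w := \sum_(i < n) _ in aS.
pose g x := \sum_(j <- r) f j w * f j x.
have lg : linear_for *%R g.
  move=> c u v; rewrite /g mulr_sumr -big_split/=; apply: eq_bigr => j _.
  by rewrite linearP/=; ring.
have [b Ab gb] := conv_hull_exists_le _ _ g lg (Ay _ (leqnn _)).
pose a' i := if i == n then b else a i.
have a'E i : (i < n)%N -> a' i = a i by move=> iln; rewrite /a' ltn_eqF.
have a'n : a' n = b by rewrite /a' eqxx.
exists a' => [i|].
  by rewrite ltnS leq_eqVlt => /predU1P[->|iln]; rewrite ?a'n ?a'E//; exact: Aa.
rewrite !big_ord_recr/= a'n.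
under [X in X + _]eq_bigr => i _ do rewrite a'E//.
rewrite -/w; pose v := b - y n.
have -> : \sum_(j <- r) f j (w + l n *: v) ^+ 2 =
    \sum_(j <- r) f j w ^+ 2 + 2 * l n * g v + l n ^+ 2 * \sum_(j <- r) f j v ^+ 2.
  rewrite /g !mulr_sumr -!big_split/=; apply: eq_bigr => j _.
  by rewrite linearD linearZ/=; ring.
have gv : g v <= 0.
  by have := lg (-1) (y n) b; rewrite scaleN1r [- _ + _]addrC -/v => ->; lra.
have fv : \sum_(j <- r) f j v ^+ 2 <= (size r)%:R * C ^+ 2.
  have -> : (size r)%:R * C ^+ 2 = \sum_(j <- r) C ^+ 2.
    by rewrite big_const_seq count_predT iter_addr_0 mulr_natl.
  apply: ler_sum => j _; rewrite -(real_normK (num_real (f j v))).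
  rewrite lerXn2r ?nnegrE//; last exact: le_trans (fle j v) (AC _ _ (leqnn _) Ab).
  exact: le_trans (normr_ge0 _) (AC _ _ (leqnn _) Ab).
have lgv : 2 * l n * g v <= 0.
  by rewrite mulr_ge0_le0// mulr_ge0// l0.
have lfv : l n ^+ 2 * \sum_(j <- r) f j v ^+ 2 <= l n ^+ 2 * ((size r)%:R * C ^+ 2).
  by rewrite ler_wpM2l// sqr_ge0.
by rewrite mulrDr; lra.
Qed.

(** * Riemann sums *)

Lemma minkowski_bigP {R : realType} {X : normedModType R} (n : nat)
    (A : nat -> set X) (x : X) :
  (\big[minkowski_sum/[set 0]]_(i < n) A i) x <->
  exists2 a : nat -> X, forall i, (i < n)%N -> A i (a i) & x = \sum_(i < n) a i.
Proof.
elim: n A x => [|n IH] A x.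
  rewrite !big_ord0; split=> [->|[a _ ->]]; last by rewrite big_ord0.
  by exists (fun=> 0) => //; rewrite big_ord0.
rewrite big_ord_recl; split.
  move=> [b Ab [c /(IH (fun i => A i.+1))[a Aa ->] <-]].
  exists (fun i => if i is j.+1 then a j else b); first by case.
  by rewrite big_ord_recl.
move=> [a Aa ->]; rewrite big_ord_recl; exists (a 0%N); first exact: Aa.
exists (\sum_(i < n) a i.+1) => //; apply/(IH (fun i => A i.+1)).
by exists (fun i => a i.+1) => // i iln; exact: Aa.
Qed.

Lemma riemann_sumP {R : realType} {X : normedModType R} (F : R -> set X)
    (s t : seq R) (x : X) :
  riemann_sum F s t x <->
  exists2 a : nat -> X, forall i, (i < size s)%N -> F t`_i (a i) &
    x = \sum_(i < size s) subitv_length s i *: a i.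
Proof.
rewrite /riemann_sum.
rewrite (minkowski_bigP (size s) (fun i => set_scale (subitv_length s i) (F t`_i))).
split=> [[b Fb ->]|[a Fa ->]]; last first.
  by exists (fun i => subitv_length s i *: a i) => // i /Fa Fai; exists (a i).
have /choice[a aP] : forall i, exists c,
    (i < size s)%N -> F t`_i c /\ subitv_length s i *: c = b i.
  by move=> i; have [/Fb[c]|] := ltnP i (size s); [exists c|exists 0].
exists a => [i /aP[]//|]; apply: eq_bigr => i _.
by have [_ ->] := aP i (ltn_ord i).
Qed.

Lemma totally_bounded_riemann_sum {R : realType} {X : normedModType R}
    (F : R -> set X) (s t : seq R) :
  (forall i, (i < size s)%N -> totally_bounded (F t`_i)) ->
  totally_bounded (riemann_sum F s t).
Proof.
move=> tF; apply: (@big_ind _ totally_bounded).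
- exact: totally_bounded_set1.
- exact: totally_bounded_minkowski_sum.
- by move=> i _; apply: totally_bounded_scale; exact: tF.
Qed.

Section partition_lemmas.
Context {R : realType}.
Implicit Types s t : seq R.

Lemma tagged_partition_tag01 s t i :
  tagged_partition s t -> (i < size s)%N -> 0 <= t`_i <= 1.
Proof.
move=> [sP _ tP] iln; have /andP[lt tr] := tP _ iln.
rewrite (le_trans _ lt)/=; last by apply: itv_partition_nth_ge => //; exact: leqW.
by rewrite (le_trans tr)//; exact: (@itv_partition_nth_le _ _ 0 1 s i.+1).
Qed.

Lemma subitv_length_ge0 s t i :
  tagged_partition s t -> (i < size s)%N -> 0 <= subitv_length s i.
Proof.
by move=> [_ _ tP] iln; have /andP[lt tr] := tP _ iln; rewrite subr_ge0 (le_trans lt).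
Qed.

Lemma subitv_length_le_mesh s i :
  (i < size s)%N -> subitv_length s i <= mesh s.
Proof.
move=> iln; exact: (le_bigmax 0 (fun j : 'I_(size s) => subitv_length s j) (Ordinal iln)).
Qed.

Lemma sum_subitv_length s t :
  tagged_partition s t -> \sum_(i < size s) subitv_length s i = 1.
Proof.
move=> [sP _ _]; rewrite -(big_mkord xpredT (subitv_length s)).
rewrite (telescope_sumr_eq (nth 1 (0 :: s)))//.
by rewrite (itv_partition_nth_size _ sP) subr0.
Qed.

(** The source of smallness in the selection argument: each square is at most
    the mesh times the length, and the lengths add up to 1. *)
Lemma sum_sqr_subitv_length s t :
  tagged_partition s t -> \sum_(i < size s) subitv_length s i ^+ 2 <= mesh s.
Proof.
move=> st; rewrite -[leRHS]mulr1 -(sum_subitv_length s t st) mulr_sumr.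
apply: ler_sum => i _; rewrite expr2 ler_wpM2r//.
  exact: subitv_length_ge0 st _.
exact: subitv_length_le_mesh.
Qed.

Definition unif_partition (n : nat) : seq R :=
  mkseq (fun i => i.+1%:R / n.+1%:R) n.+1.

Lemma size_unif_partition n : size (unif_partition n) = n.+1.
Proof. exact: size_mkseq. Qed.

Lemma unif_partition_right n i :
  (i <= n)%N -> subitv_right (unif_partition n) i = i.+1%:R / n.+1%:R.
Proof. by move=> iln; rewrite /subitv_right nth_mkseq. Qed.

Lemma unif_partition_left n i :
  (i <= n)%N -> subitv_left (unif_partition n) i = i%:R / n.+1%:R.
Proof.
case: i => [|i] iln; rewrite /subitv_left /=; first by rewrite mul0r.
by rewrite nth_mkseq// ltnW.
Qed.

Lemma unif_partition_length n i :
  (i <= n)%N -> subitv_length (unif_partition n) i = n.+1%:R^-1.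
Proof.
move=> iln; rewrite /subitv_length unif_partition_right// unif_partition_left//.
by rewrite -mulrBl -natrB// subSnn mul1r.
Qed.

Lemma mesh_unif_partition n : mesh (unif_partition n) <= n.+1%:R^-1.
Proof.
apply: bigmax_le => [|i _]; first by rewrite invr_ge0.
have := ltn_ord i; rewrite {2}size_unif_partition ltnS => iln.
by rewrite unif_partition_length.
Qed.

Lemma unif_partitionP n : itv_partition 0 1 (unif_partition n).
Proof.
split.
  apply/(pathP 1) => i; rewrite size_unif_partition ltnS => iln.
  have := unif_partition_length n i iln; rewrite /subitv_length => lenE.
  by rewrite -subr_gt0 [ltRHS]lenE invr_gt0.
rewrite (last_nth 1) size_unif_partition.
rewrite /= -/(subitv_right (unif_partition n) n).
by rewrite unif_partition_right// divff.
Qed.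

Lemma unif_partition_itv n (t : R) : 0 <= t <= 1 ->
  exists2 i, (i <= n)%N &
  subitv_left (unif_partition n) i <= t <= subitv_right (unif_partition n) i.
Proof.
move=> /andP[t0 t1]; pose P i := t <= i.+1%:R / n.+1%:R.
have Pn : P n by rewrite /P divff.
(* The first right endpoint that is at least [t]. *)
case: (ex_minnP (ex_intro P n Pn)) => i Pi imin.
have iln := imin _ Pn; exists i => //.
rewrite unif_partition_left// unif_partition_right// [X in _ && X]Pi andbT.
case: i imin {Pi iln} => [|i] imin; first by rewrite mul0r.
by have [//|/ltW/imin] := leP (i.+1%:R / n.+1%:R) t; rewrite ltnn.
Qed.

Lemma unif_partition_tagged n (u : nat -> R) :
  (forall i, (i <= n)%N ->
    subitv_left (unif_partition n) i <= u i <=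
    subitv_right (unif_partition n) i) ->
  tagged_partition (unif_partition n) (mkseq u n.+1).
Proof.
move=> uP; split; first exact: unif_partitionP.
  by rewrite size_mkseq size_unif_partition.
by move=> i; rewrite size_unif_partition => iln; rewrite nth_mkseq//; exact: uP.
Qed.

Lemma fine_unif_partition (d : R) :
  0 < d -> exists n, mesh (unif_partition n) < d.
Proof.
move=> d0; have [n nd] := ltr_add_invr d0.
by exists n; apply: le_lt_trans (mesh_unif_partition n) _; rewrite add0r in nd.
Qed.

End partition_lemmas.

(** * Riemann integrability *)

Section hausdorff_lemmas.
Context {R : realType} {X : normedModType R}.
Implicit Types A B : set X.

Lemma dist_to_set_ltP (x : X) A (e : R) :
  (dist_to_set x A < e%:E)%E <-> exists2 a, A a & `|x - a| < e.
Proof.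
split=> [/ereal_inf_lt[_ [a Aa <-]]|[a Aa xa]]; first by rewrite lte_fin; exists a.
apply: (@le_lt_trans _ _ (`|x - a|)%:E); last by rewrite lte_fin.
by apply: ereal_inf_lbound; exists a.
Qed.

Lemma hausdorff_dist_lt A B (e : R) : (hausdorff_dist A B < e%:E)%E ->
  (forall a, A a -> exists2 b, B b & `|a - b| < e) /\
  (forall b, B b -> exists2 a, A a & `|b - a| < e).
Proof.
rewrite /hausdorff_dist gt_max => /andP[BA AB]; split=> x Sx; apply/dist_to_set_ltP.
  by apply: le_lt_trans AB; apply: ereal_sup_ubound; exists x.
by apply: le_lt_trans BA; apply: ereal_sup_ubound; exists x.
Qed.

Lemma hausdorff_dist_le A B (e : R) :
  (forall a, A a -> exists2 b, B b & `|a - b| < e) ->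
  (forall b, B b -> exists2 a, A a & `|b - a| < e) ->
  (hausdorff_dist A B <= e%:E)%E.
Proof.
move=> AB BA; rewrite /hausdorff_dist ge_max; apply/andP; split.
  by apply: ge_ereal_sup => _ [b /BA/dist_to_set_ltP/ltW + <-].
by apply: ge_ereal_sup => _ [a /AB/dist_to_set_ltP/ltW + <-].
Qed.

End hausdorff_lemmas.

(** Riemann sums over a fine partition lie in a fixed ball.  Fix such a partition
    and move a single tag: two such sums differ by [l_i *: (a - c)] with [a] in
    an arbitrary [G t] and [c] in a value of [G] at one of finitely many
    points. *)
Lemma riemann_integrable_bounded {R : realType} {X : normedModType R}
    (G : R -> set X) :
  (forall t, 0 <= t <= 1 -> G t !=set0) -> riemann_integrable G ->
  exists M, forall t a, 0 <= t <= 1 -> G t a -> `|a| <= M.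
Proof.
move=> G0 [A [[[_ [M0 [_ AM0]]] _] /(_ 1 ltr01)[d d0 dA]]].
pose B := M0 + 2.
have sumB s t x : tagged_partition s t -> mesh s < d -> riemann_sum G s t x ->
    `|x| <= B.
  move=> st sd Sx; have [/(_ _ Sx)[a Aa xa] _] := hausdorff_dist_lt _ _ _ (dA _ _ st sd).
  have := AM0 (M0 + 1); rewrite ltrDl ltr01 => /(_ isT _ Aa) /= aM.
  by have := ler_normD (x - a) a; rewrite subrK /B; lra.
have [n nd] := fine_unif_partition d d0; set s := unif_partition n in nd.
have right01 i : (i <= n)%N -> 0 <= subitv_right s i <= 1.
  move=> iln; rewrite unif_partition_right// divr_ge0//=.
  by rewrite ler_pdivrMr// mul1r ler_nat.
have rightP i : (i <= n)%N -> subitv_left s i <= subitv_right s i <= subitv_right s i.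
  move=> iln; rewrite lexx andbT -subr_ge0 -/(subitv_length s i).
  by rewrite unif_partition_length// invr_ge0.
have /choice[c cP] : forall t, exists b : X, 0 <= t <= 1 -> G t b.
  move=> t; have [t01|] := boolP (0 <= t <= 1); last by exists 0.
  by have [b Gb] := G0 _ t01; exists b.
exists (\sum_(i < n.+1) `|c (subitv_right s i)| + n.+1%:R * (2 * B)) => t a t01 Ga.
have [i iln ti] := unif_partition_itv n t t01.
pose u j := if j == i then t else subitv_right s j.
pose b j := if j == i then a else c (subitv_right s j).
pose Sb := \sum_(j < n.+1) n.+1%:R^-1 *: b j.
pose Sc := \sum_(j < n.+1) n.+1%:R^-1 *: c (subitv_right s j).
have SbB : `|Sb| <= B.
  apply: (sumB s (mkseq u n.+1)) => //.
    by apply: unif_partition_tagged => j jln; rewrite /u; case: eqVneq => [->//|_]; exact: rightP.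
  apply/riemann_sumP; exists b => [j|].
    rewrite size_unif_partition => jln.
    by rewrite nth_mkseq// /u /b; case: eqVneq => // _; exact/cP/right01.
  rewrite size_unif_partition.
  by apply: eq_bigr => j _; rewrite unif_partition_length// -ltnS.
have ScB : `|Sc| <= B.
  apply: (sumB s (mkseq (subitv_right s) n.+1)) => //.
    exact: unif_partition_tagged.
  apply/riemann_sumP; exists (fun j => c (subitv_right s j)) => [j|].
    by rewrite size_unif_partition => jln; rewrite nth_mkseq//; exact/cP/right01.
  rewrite size_unif_partition.
  by apply: eq_bigr => j _; rewrite unif_partition_length// -ltnS.
have SbcE : Sb - Sc = n.+1%:R^-1 *: (a - c (subitv_right s i)).
  rewrite /Sb /Sc -sumrB (bigD1 (Ordinal (iln : (i < n.+1)%N)))//= big1 => [|j ji].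
    by rewrite addr0 -scalerBr /b eqxx.
  by rewrite /b ifN ?subrr//.
have ac : `|a - c (subitv_right s i)| <= n.+1%:R * (2 * B).
  rewrite -ler_pdivrMl// -[X in X * _]ger0_norm ?invr_ge0// -normrZ -SbcE.
  by have := ler_normB Sb Sc; lra.
have ci : `|c (subitv_right s i)| <= \sum_(j < n.+1) `|c (subitv_right s j)|.
  by rewrite (bigD1 (Ordinal (iln : (i < n.+1)%N)))//= lerDl sumr_ge0.
by have := ler_normD (a - c (subitv_right s i)) (c (subitv_right s i)); rewrite subrK; lra.
Qed.

(** The integral is a Hausdorff limit of Riemann sums, which are totally
    bounded. *)
Lemma totally_bounded_riemann_integral {R : realType} {X : normedModType R}
    (G : R -> set X) (A : set X) :
  (forall t, 0 <= t <= 1 -> totally_bounded (G t)) -> is_riemann_integral G A ->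
  totally_bounded A.
Proof.
move=> tG [_ GA]; apply: totally_bounded_approx => e /GA[d d0 dA].
have [n nd] := fine_unif_partition d d0.
pose t : seq R := mkseq (subitv_right (unif_partition n)) n.+1.
have st : tagged_partition (unif_partition n) t.
  apply: unif_partition_tagged => i iln.
  rewrite lexx andbT -subr_ge0 -/(subitv_length (unif_partition n) i).
  by rewrite unif_partition_length// invr_ge0.
exists (riemann_sum G (unif_partition n) t).
  apply: totally_bounded_riemann_sum => i ilt.
  by apply: tG; exact: tagged_partition_tag01 st ilt.
by have [_] := hausdorff_dist_lt _ _ _ (dA _ _ st nd).
Qed.

Lemma riemann_sum_sub_conv_hull {R : realType} {X : normedModType R}
    (F : R -> set X) (s t : seq R) :
  riemann_sum F s t `<=` riemann_sum (fun t => conv_hull (F t)) s t.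
Proof.
move=> x /riemann_sumP[a Fa ->]; apply/riemann_sumP; exists a => // i /Fa.
exact: sub_conv_hull.
Qed.

(** The heart of the proof.  The net [r] of [A - A] is fixed before the
    partition, so the size of the family of norming functionals does not
    compete with the mesh. *)
Lemma riemann_sum_conv_hull_approx {R : realType} {X : normedModType R}
    (F : R -> set X) (A : set X) :
  (forall t, 0 <= t <= 1 -> F t !=set0) ->
  totally_bounded A ->
  is_riemann_integral (fun t => conv_hull (F t)) A ->
  forall e : R, 0 < e -> exists2 d : R, 0 < d &
    forall s t, tagged_partition s t -> mesh s < d ->
    forall y, riemann_sum (fun t => conv_hull (F t)) s t y ->
    exists2 x, riemann_sum F s t x & `|y - x| < e.
Proof.
move=> F0 tA GA e e0; have [M FM] : exists M, forall t a, 0 <= t <= 1 ->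
    conv_hull (F t) a -> `|a| <= M.
  apply: riemann_integrable_bounded; last by exists A.
  by move=> t /F0[a Fa]; exists a; exact: sub_conv_hull.
(* [x - y] will be within [3 * h] of the net, namely [2 * h] for the distances
   of [x] and [y] to [A] and [h] for the net, and the functionals will be at most
   [h] on it; its norm is then less than [h + 2 * (3 * h) = 7 * h]. *)
pose h := e / 8; have h0 : 0 < h by rewrite divr_gt0.
have [f fP] := norming_functionals X.
have [_ /finite_seqP[r ->] rA] :=
  totally_bounded_minkowski_sum _ _ tA (totally_bounded_scale (-1) _ tA) h h0.
have [d1 d10 d1A] := GA.2 _ h0.
pose K := (size r)%:R * (2 * M) ^+ 2 : R.
have K0 : 0 <= K by rewrite mulr_ge0// sqr_ge0.
(* The selection bounds the sum of the squares by [K * mesh s]. *)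
exists (Num.min d1 (h ^+ 2 / (K + 1))).
  by rewrite lt_min d10 divr_gt0 ?exprn_gt0// ltr_wpDl.
move=> s t st; rewrite lt_min => /andP[sd1 sd2] y Sy.
have [nearA _] := hausdorff_dist_lt _ _ _ (d1A _ _ st sd1).
have [b Fb yE] := (riemann_sumP _ _ _ _).1 Sy.
have [] := @sum_squares_selection R X X f r (size s) (subitv_length s)
  (fun i => F t`_i) b (2 * M).
- by move=> j z; exact: (fP j).2.
- by move=> i; exact: subitv_length_ge0 st.
- exact: Fb.
- move=> i a iln Fa; have t01 := tagged_partition_tag01 _ _ _ st iln.
  have := FM _ _ t01 (Fb _ iln); have := FM _ _ t01 (sub_conv_hull _ _ Fa).
  by have := ler_normB a (b i); lra.
move=> a Fa; pose x := \sum_(i < size s) subitv_length s i *: a i.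
have Sx : riemann_sum F s t x by apply/riemann_sumP; exists a.
under eq_bigr => i _ do under eq_bigr => j _ do rewrite scalerBr.
rewrite sumrB -/x -yE => sqle; exists x => //; rewrite distrC.
have [p Ap xp] := nearA _ (riemann_sum_sub_conv_hull _ _ _ _ Sx).
have [q Aq yq] := nearA _ Sy.
have [z rz zpq] : exists2 z, z \in r & `|z - (p - q)| < h.
  have [|z /= rz] := rA (p - q); last by rewrite -ball_normE /=; exists z.
  by exists p => //; exists (- q) => //; exists q => //; rewrite scaleN1r.
have zxy : `|z - (x - y)| < 3 * h.
  have := ler_distD (p - q) z (x - y).
  have := ler_normD (p - x) (y - q); rewrite distrC in xp.
  have -> : p - x + (y - q) = p - q - (x - y).
    by rewrite opprB addrACA [in RHS]addrACA [- x - q]addrC.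
  lra.
have fz : f z (x - y) <= h.
  rewrite leNgt; apply/negP => hf.
  have : h ^+ 2 < f z (x - y) ^+ 2 by rewrite ltrXn2r// ?ltW// nnegrE ltW// (lt_trans h0).
  apply/negP; rewrite -leNgt; apply: (@le_trans _ _ (K * mesh s)).
    have fsum : f z (x - y) ^+ 2 <= \sum_(j <- r) f j (x - y) ^+ 2.
      by rewrite (big_rem z)//= lerDl sumr_ge0// => j _; exact: sqr_ge0.
    apply: (le_trans fsum); apply: (le_trans sqle).
    by rewrite -/K ler_wpM2l//; exact: sum_sqr_subitv_length st.
  move: sd2; rewrite ltr_pdivlMr ?ltr_wpDl// => sd2.
  have : 0 <= mesh s.
    apply: le_trans (sum_sqr_subitv_length _ _ st).
    by apply: sumr_ge0 => i _; exact: sqr_ge0.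
  by rewrite mulrC; lra.
have := norm_lt_near_normed (f z) z (x - y) h (3 * h) (fP z).1 (fP z).2 zxy fz.
by rewrite /h; lra.
Qed.

Theorem corollary4p4 (R : realType) (X : completeNormedModType R)
  (F : R -> set X)
  (Fb : forall t : R, 0 <= t <= 1 -> bX (F t))
  (Fpc : forall t : R, 0 <= t <= 1 -> precompact (F t))
  (Fconv : riemann_integrable (fun t => conv_hull (F t))) :
  riemann_integrable F.
Proof.
have [A AP] := Fconv; have [clA GA] := AP; exists A; split=> // e e0.
have tA : totally_bounded A.
  apply: totally_bounded_riemann_integral AP => t t01.
  exact/totally_bounded_conv_hull/precompact_totally_bounded/Fpc.
have e40 : 0 < e / 4 by rewrite divr_gt0.
have [d1 d10 near_conv] := GA _ e40.
have [d2 d20 near_sum] := riemann_sum_conv_hull_approx F A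
  (fun t t01 => (Fb t t01).1) tA AP _ e40.
exists (Num.min d1 d2); first by rewrite lt_min d10.
move=> s t st; rewrite lt_min => /andP[sd1 sd2].
have [convA Aconv] := hausdorff_dist_lt _ _ _ (near_conv _ _ st sd1).
apply: (@le_lt_trans _ _ (e / 2)%:E); last by rewrite lte_fin; lra.
apply: hausdorff_dist_le => [x Sx|a Aa].
  have [a Aa xa] := convA _ (riemann_sum_sub_conv_hull _ _ _ _ Sx).
  by exists a => //; lra.
have [y /(near_sum _ _ st sd2)[x Sx yx] ay] := Aconv _ Aa.
exists x => //; have := ler_distD y a x; lra.
Qed.
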